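(* Let $X$ be an infinite-dimensional reflexive real Banach space and let $\{f_n\}_{n\in\mathbb{N}}\subset X^*\setminus U_{X^*}$ (that is, $f_n\in X^*$ and $\|f_n\|\ge 1$ for each $n\in\mathbb{N}$). For each $n\in\mathbb{N}$, let $S_n$ be one of the following two sets: $$\{x\in X:\ f_n(x)\geq 1\},\qquad \{x\in X:\ f_n(x)>1\}.$$ Let $\mathcal{S}=\{S_n\}_{n\in\mathbb{N}}$ and suppose that $S_X\subset\bigcup\mathcal{S}$. Then $\mathcal{S}$ is not point-finite.
   Context: $X^*$ is the dual Banach space of $X$, $U_{X^*}$ is the open unit ball of $X^*$, and $S_X=\{x\in X:\|x\|=1\}$ is the unit sphere of $X$. $\bigcup\mathcal{S}$ denotes the union of all members of $\mathcal{S}$. A family of subsets of $X$ is point-finite if each $x\in X$ is contained in at most finitely many members of the family. For each $n$ the choice between the two sets is made independently. *)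

(* Defs.v *)
From HB Require Import structures.
From mathcomp Require Import all_boot all_order all_algebra.
From mathcomp Require Import all_classical all_reals all_analysis.

Set Implicit Arguments.
Unset Strict Implicit.
Unset Printing Implicit Defensive.
Import Order.TTheory GRing.Theory Num.Theory.
Import numFieldNormedType.Exports.

Local Open Scope classical_set_scope.
Local Open Scope ring_scope.

Section dual.
Context {R : realType} (X : normedModType R).

Definition continuous_functional : {pred X -> R^o} :=
  [pred f : X -> R^o | `[< linear f /\ continuous f >]].

Lemma continuous_functionalP (f : X -> R^o) :
  reflect (linear f /\ continuous f) (f \in continuous_functional).
Proof. exact: asboolP. Qed.

Record dual := Dual {
  dual_fun :> X -> R^o ;
  dual_funP : dual_fun \in continuous_functional }.

HB.instance Definition _ := [isSub of dual for dual_fun].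
HB.instance Definition _ := [Choice of dual by <:].

Lemma continuous_functional_submod : submod_closed continuous_functional.
Proof.
split.
  apply/continuous_functionalP; split; last exact: cst_continuous.
  by move=> a x y; rewrite /GRing.zero/= scaler0 addr0.
move=> a f g /continuous_functionalP[lf cf] /continuous_functionalP[lg cg].
apply/continuous_functionalP; split.
  move=> b x y.
  have E z : (a *: f + g) z = a * f z + g z by [].
  rewrite !E lf lg /GRing.scale/= !mulrDr !mulrA (mulrC a b).
  by rewrite -!addrA; congr (_ + _); rewrite addrCA.
move=> x; apply: cvgD; last exact: cg.
by apply: cvgZr; exact: cf.
Qed.

HB.instance Definition _ :=
  GRing.isSubmodClosed.Build _ _ continuous_functional
    continuous_functional_submod.

HB.instance Definition _ := [SubChoice_isSubLmodule of dual by <:].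

(* [sup] over the closed unit ball, a genuine supremum by
   [dual_norm_has_sup]. *)
Definition dual_norm (f : dual) : R :=
  sup [set `|f x| | x in [set x : X | `|x| <= 1]].

Lemma dual_linear (f : dual) : linear f.
Proof. by have /continuous_functionalP[] := dual_funP f. Qed.

Lemma dual_continuous (f : dual) : continuous f.
Proof. by have /continuous_functionalP[] := dual_funP f. Qed.

Lemma dualZ (f : dual) a x : f (a *: x) = a * f x.
Proof.
have f0 : f 0 = 0.
  have := dual_linear f (-1) 0 0.
  by rewrite scaler0 addr0 scaleN1r addNr.
by rewrite -[a *: x]addr0 dual_linear f0 addr0.
Qed.

Lemma dual_norm_has_sup (f : dual) :
  has_sup [set `|f x| | x in [set x : X | `|x| <= 1]].
Proof.
split; first by exists `|f 0|, 0 => //=; rewrite normr0.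
pose l : {linear X -> R^o} :=
  HB.pack (f : X -> R^o) (GRing.isLinear.Build _ _ _ _ _ (dual_linear f)).
have /bounded_funP/(_ 1)[M fM] : bounded_near l (nbhs 0).
  by apply/linear_bounded_continuous; exact: dual_continuous.
by exists M => _ [x x1 <-]; exact: fM.
Qed.

Lemma dual_norm_ub (f : dual) x : `|x| <= 1 -> `|f x| <= dual_norm f.
Proof.
move=> x1; apply: sup_upper_bound; first exact: dual_norm_has_sup.
by exists x.
Qed.

Lemma dual_norm_le (f : dual) M :
  (forall x, `|x| <= 1 -> `|f x| <= M) -> dual_norm f <= M.
Proof.
move=> fM; apply: ge_sup; first by case: (dual_norm_has_sup f).
by move=> _ [x x1 <-]; exact: fM.
Qed.

Lemma ler_dual_normD (f g : dual) :
  dual_norm (f + g) <= dual_norm f + dual_norm g.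
Proof.
apply: dual_norm_le => x x1; rewrite (le_trans (ler_normD (f x) (g x)))//.
by rewrite lerD// dual_norm_ub.
Qed.

Lemma ler_dual_normZ (a : R) (f : dual) :
  dual_norm (a *: f) <= `|a| * dual_norm f.
Proof.
apply: dual_norm_le => x x1; rewrite [leLHS](normrM a (f x)).
by rewrite ler_wpM2l// dual_norm_ub.
Qed.

Lemma dual_normZ (a : R) (f : dual) : dual_norm (a *: f) = `|a| * dual_norm f.
Proof.
apply/eqP; rewrite eq_le ler_dual_normZ/=.
have [->|a0] := eqVneq a 0.
  by rewrite normr0 mul0r (le_trans _ (@dual_norm_ub _ 0 _)) ?normr0.
rewrite mulrC -ler_pdivlMr ?normr_gt0// mulrC -normfV.
by rewrite -[in leLHS](scalerK a0 f) ler_dual_normZ.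
Qed.

Lemma dual_norm_eq0 (f : dual) : dual_norm f = 0 -> f = 0.
Proof.
move=> f0; apply/val_inj/funext => x /=.
have [->|x0] := eqVneq x 0; first by rewrite -(scale0r 0) dualZ mul0r.
have : `|f (`|x|^-1 *: x)| <= 0.
  rewrite -f0 dual_norm_ub// normrZ normfV normr_id mulVf//.
  by rewrite normr_eq0.
rewrite normr_le0 dualZ mulf_eq0 invr_eq0 normr_eq0 (negPf x0)/=.
by move/eqP.
Qed.

HB.instance Definition _ :=
  Lmodule_isNormed.Build R dual ler_dual_normD dual_normZ dual_norm_eq0.

Lemma dual_normE (f : dual) :
  `|f| = sup [set `|f x| | x in [set x : X | `|x| <= 1]].
Proof. by []. Qed.
End dual.

(* The canonical embedding of [X] into its bidual is onto, where [dual (dual X)]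
   is taken with respect to the norm topology of [dual X]. *)
Definition reflexive_space (R : realType) (X : normedModType R) :=
  forall phi : dual (dual X), exists x : X, forall f : dual X, phi f = f x.

Definition finite_dimensional (R : realType) (V : lmodType R) :=
  exists n (e : 'I_n -> V), forall v, exists a : 'I_n -> R,
    v = \sum_(i < n) a i *: e i.

(* Members are counted as sets: for an indexed family, take [F := range S], so
   that repeated members count once. *)
Definition point_finite (T : Type) (F : set (set T)) :=
  forall x, finite_set [set A | F A /\ A x].

(* Main.v *)
(** Suppose the family is point-finite. A slice determines its functional, so
    for every [x] and [e > 0] only finitely many distinct functionals satisfy
    [e <= |f_n x|]; as the slices cover the sphere, [x |-> (f_n x)_n] embeds
    [X] into [c_0] with [|x| <= sup_n |f_n x|]. A gliding hump then gives a
    bounded sequence [s_k] of sums of vectors whose images are almost disjoint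
    blocks. Reflexivity yields a weak limit [s] of the [s_k], but
    [1/2 <= |f_n s|] for infinitely many distinct [f_n]. *)
From HB Require Import structures.
Require Import Defs.
From mathcomp Require Import all_boot all_order all_algebra.
From mathcomp Require Import all_classical all_reals all_analysis.
From mathcomp Require Import lra.

Import Order.TTheory GRing.Theory Num.Theory.
Import numFieldNormedType.Exports.
Local Open Scope classical_set_scope.
Local Open Scope ring_scope.

(** * Linearity and norm bounds for elements of the dual *)

HB.instance Definition _ (R : realType) (X : normedModType R) (g : dual X) :=
  GRing.isLinear.Build R X R^o _ (dual_fun g) (dual_linear g).

Lemma dualD (R : realType) (X : normedModType R) (g : dual X) x y :
  g (x + y) = g x + g y.
Proof. exact: linearD. Qed.

Lemma dualN (R : realType) (X : normedModType R) (g : dual X) x :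
  g (- x) = - g x.
Proof. exact: linearN. Qed.

Lemma dual_le (R : realType) (X : normedModType R) (g : dual X) x :
  `|g x| <= `|g| * `|x|.
Proof.
have [->|x0] := eqVneq x 0; first by rewrite linear0 !normr0 mulr0.
have nx0 : 0 < `|x| by rewrite normr_gt0.
rewrite -ler_pdivrMr// mulrC -{1}[`|x|]gtr0_norm// -normfV -normrM -dualZ.
by apply: dual_norm_ub; rewrite normrZ normfV normr_id mulVf ?gt_eqF.
Qed.

(** * Limits along ultrafilters and weak limits in reflexive spaces *)

Lemma ultra_fmap (T V : Type) (h : T -> V) (U : set_system T) :
  UltraFilter U -> UltraFilter (h @ U).
Proof.
move=> ultraU; have properU : ProperFilter U by exact: ultra_proper.
split; first exact: fmap_proper_filter.
move=> G properG hUG; apply/seteqP; split => // A GA.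
have [//|UnA] := in_ultra_setVsetC (h @^-1` A) ultraU.
have GnA : G (~` A) by apply: hUG.
have : G (A `&` ~` A) by exact: filterI.
by rewrite setICr => /filter_not_empty.
Qed.

Lemma ultra_bounded_cvg (R : realType) (T : Type) (U : set_system T)
    (u : T -> R) (M : R) :
  UltraFilter U -> (forall t, `|u t| <= M) ->
  exists2 l, `|l| <= M & u t @[t --> U] --> l.
Proof.
move=> ultraU uM; have properU : ProperFilter U by exact: ultra_proper.
have := @segment_compact R (- M) M; rewrite compact_ultra /= => segU.
have [|l [lM ul]] := segU _ (ultra_fmap _ _ u U ultraU); last first.
  by exists l => //; move: lM; rewrite /= in_itv/= -ler_norml.
by rewrite fmapE; apply: filterE => t /=; rewrite in_itv/= -ler_norml uM.
Qed.

(* The limits of [h \o s] along [U] define an element of the bidual. *)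
Lemma reflexive_ultra_weak_cvg (R : realType) (X : normedModType R)
    (T : Type) (U : set_system T) (s : T -> X) (M : R) :
  reflexive_space X -> UltraFilter U -> (forall t, `|s t| <= M) ->
  exists x, forall h : dual X, h (s t) @[t --> U] --> h x.
Proof.
move=> reflX ultraU sM; have properU : ProperFilter U by exact: ultra_proper.
have hsM (h : dual X) t : `|h (s t)| <= `|h| * M.
  by rewrite (le_trans (dual_le _ _ _ _))// ler_wpM2l.
have /choice[phi phiP] (h : dual X) : exists l : R,
    `|l| <= `|h| * M /\ h (s t) @[t --> U] --> l.
  by have [l] := ultra_bounded_cvg _ _ U _ _ ultraU (hsM h); exists l.
have phi_lin : linear (phi : dual X -> R^o).
  move=> a g h.
  apply: (@cvg_unique _ (@Rhausdorff R) (((a *: g + h) (s t)) @[t --> U])).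
    by have [] := phiP (a *: g + h).
  by apply: cvgD; [apply: cvgMr|]; case: (phiP g); case: (phiP h).
pose phil : {linear dual X -> R^o} :=
  HB.pack (phi : dual X -> R^o) (GRing.isLinear.Build _ _ _ _ _ phi_lin).
have phi_cont : continuous (phi : dual X -> R^o).
  apply: (linear_bounded_continuous phil).1; apply/linear_boundedP.
  exists M; split=> [|r /ltW Mr h]; first exact: num_real.
  by rewrite (le_trans (phiP h).1)// mulrC ler_wpM2r.
have phi_dual : (phi : dual X -> R^o) \in @continuous_functional R (dual X).
  exact/continuous_functionalP.
have [x xP] := reflX (Dual phi_dual).
by exists x => h; rewrite -xP; case: (phiP h).
Qed.

(** * Common kernels of finitely many functionals *)

(** By induction on [G]: either the new functional vanishes on the common kernel of the earlier ones
    and [e] still works, or it is nonzero at some [u] of that kernel, and [u] joins [e]. *)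
Lemma modulo_common_kernel (R : realType) (X : normedModType R)
    (G : seq (dual X)) :
  exists n (e : 'I_n -> X), forall v, exists a : 'I_n -> R,
    forall g, g \in G -> g (v - \sum_(i < n) a i *: e i) = 0.
Proof.
elim: G => [|g G [n [e eP]]]; first by exists 0%N, (fun=> 0) => v; exists (fun=> 0).
have [[u uG gu]|gG] := pselect (exists2 u, {in G, forall h : dual X, h u = 0} & g u != 0).
  exists n.+1, (fun i => oapp e u (unlift ord0 i)) => v.
  have [a aP] := eP v; pose w := v - \sum_(i < n) a i *: e i.
  exists (fun i => oapp a (g w / g u) (unlift ord0 i)) => h.
  rewrite big_ord_recl unlift_none/=.
  under eq_bigr do rewrite liftK/=.
  rewrite (addrC (_ *: _)) opprD addrA -/w inE => /orP[/eqP->|hG].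
    by rewrite dualD dualN dualZ divfK// subrr.
  by rewrite dualD dualN dualZ (uG _ hG) mulr0 subr0 aP.
exists n, e => v; have [a aP] := eP v; exists a => h; rewrite inE.
case/orP => [/eqP->|/aP//]; apply/eqP/negPn/negP => gw; apply: gG.
by eexists; [exact: aP|].
Qed.

Lemma common_kernel_nontrivial (R : realType) (X : normedModType R)
    (G : set (dual X)) :
  ~ finite_dimensional X -> finite_set G ->
  exists2 x, x != 0 & forall g, G g -> g x = 0.
Proof.
move=> infX /finite_seqP[s ->]; have [n [e eP]] := modulo_common_kernel _ _ s.
apply: contra_notP infX => ker0; exists n, e => v; have [a aP] := eP v.
exists a; apply/eqP; rewrite -subr_eq0; apply/negPn/negP => w0.
by apply: ker0; eexists; [exact: w0|exact: aP].
Qed.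

(** * The gliding hump and its conflict with reflexivity *)

Lemma finite_set_max (R : realDomainType) (T : choiceType) (A : set T)
    (h : T -> R) :
  finite_set A -> A !=set0 -> exists2 x, A x & forall y, A y -> h y <= h x.
Proof.
move=> /finite_seqP[s ->] {A}; elim: s => [|x s ih]; first by case.
case: s ih => [|y s] ih _.
  exists x => [|y]; first by rewrite /= mem_head.
  by rewrite /= inE => /eqP->.
have [|z zs zmax] := ih; first by exists y; rewrite /= inE eqxx.
have [zx|xz] := leP (h z) (h x).
  exists x => [|w]; first by rewrite /= mem_head.
  by rewrite /= inE => /orP[/eqP->//|ws]; rewrite (le_trans _ zx)// zmax.
exists z => [|w]; first by rewrite /= inE zs orbT.
by rewrite /= inE => /orP[/eqP->|/zmax//]; exact: ltW.
Qed.

(** For [x != 0] in the common kernel of [G], the supremum of [|g x|] over [F] is attained, since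
    only finitely many values, and at least one, reach the level [|x|]. Dividing [x] by this maximum
    gives the vector. *)
Lemma normalized_in_common_kernel (R : realType) (X : normedModType R)
    (F G : set (dual X)) :
  ~ finite_dimensional X ->
  (forall x e, 0 < e -> finite_set [set g | F g /\ e <= `|g x|]) ->
  (forall x, exists2 g, F g & `|x| <= `|g x|) ->
  finite_set G ->
  exists x, [/\ forall g, G g -> g x = 0, forall g, F g -> `|g x| <= 1 &
    exists2 g, F g & `|g x| = 1].
Proof.
move=> infX Ffin Fnorm finG.
have [x x0 xG] := common_kernel_nontrivial _ _ _ infX finG.
have nx0 : 0 < `|x| by rewrite normr_gt0.
have [|g [Fg gx] gmax] := finite_set_max _ _ _
    (fun g : dual X => `|g x|) (Ffin x _ nx0).
  by have [g Fg gx] := Fnorm x; exists g.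
have gx0 : 0 < `|g x| := lt_le_trans nx0 gx.
have scale (h : dual X) : `|h (`|g x|^-1 *: x)| = `|h x| / `|g x|.
  by rewrite dualZ normrM normfV normr_id mulrC.
exists (`|g x|^-1 *: x); split.
- by move=> h Gh; rewrite dualZ (xG _ Gh) mulr0.
- move=> h Fh; rewrite scale ler_pdivrMr// mul1r.
  by have [hx|/ltW hx] := leP `|x| `|h x|; [exact: gmax|exact: le_trans gx].
- by exists g => //; rewrite scale divff// gt_eqF.
Qed.

Lemma gliding_hump (R : realType) (X : normedModType R) (F : set (dual X)) :
  ~ finite_dimensional X ->
  (forall x e, 0 < e -> finite_set [set g | F g /\ e <= `|g x|]) ->
  (forall x, exists2 g, F g & `|x| <= `|g x|) ->
  exists (s : nat -> X) (g : nat -> dual X),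
    [/\ forall k, `|s k| <= 3 / 2,
        forall k, F (g k),
        injective g &
        forall k j, (k < j)%N -> g k (s j) = g k (s k.+1) /\
                                 1 / 2 <= `|g k (s j)|].
Proof.
move=> infX Ffin Fnorm.
(* [p.1] is the current sum; [p.2] is a finite set of functionals whose values are frozen from now
   on. It must contain every member of [F] exceeding 1/2 in absolute value at [p.1]. *)
pose inv (p : X * set (dual X)) :=
  [/\ finite_set p.2, forall g, F g -> `|g p.1| <= 3 / 2 &
      forall g, F g -> ~ p.2 g -> `|g p.1| <= 1 / 2].
pose next (p q : X * set (dual X)) :=
  [/\ p.2 `<=` q.2, forall g, p.2 g -> g q.1 = g p.1 &
      exists g, [/\ F g, ~ p.2 g, q.2 g & 1 / 2 <= `|g q.1|]].
have step p : inv p -> exists q, inv q /\ next p q.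
  case: p => s G [/= finG sF sFG].
  have [x [xG xF [g Fg gx]]] :=
    normalized_in_common_kernel _ _ _ _ infX Ffin Fnorm finG.
  have nGg : ~ G g by move/xG => gx0; move: gx; rewrite gx0 normr0; lra.
  (* [|g x| = 1], and [|g s| <= 1/2] because [g] is not yet frozen. *)
  have gsx : 1 / 2 <= `|g (s + x)|.
    rewrite dualD addrC (le_trans _ (lerB_normD _ _))// gx.
    by have := sFG _ Fg nGg; lra.
  exists (s + x, G `|` [set h | F h /\ 1 / 2 <= `|h (s + x)|]); split; split => /=.
  - by rewrite finite_setU; split => //; apply: Ffin; lra.
  (* A frozen [h] keeps its value, as [x] lies in its kernel; for the others the bound is 1/2 + 1,
     whence the constant 3/2. *)
  - move=> h Fh; rewrite dualD; have [/xG ->|nGh] := pselect (G h).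
      by rewrite addr0 sF.
    rewrite (le_trans (ler_normD _ _))//.
    by have := sFG _ Fh nGh; have := xF _ Fh; lra.
  - move=> h Fh /not_orP[_ /not_andP[//|/negP]].
    by rewrite -ltNge => /ltW.
  - exact: subsetUl.
  - by move=> h Gh; rewrite dualD (xG _ Gh) addr0.
  - by exists g; split => //; right.
pose next' (p q : {p | inv p}) := next (sval p) (sval q).
have inv0 : inv (0, set0).
  by split => //= g _; rewrite linear0 normr0; lra.
have [|t [t0 tS]] := @dependent_choice _ next' _ (exist _ _ inv0).
  move=> [p ip]; apply: cid; have [q [iq pq]] := step p ip.
  by exists (exist _ q iq).
pose s k := (sval (t k)).1; pose G k := (sval (t k)).2.
have Gmono i j : (i <= j)%N -> G i `<=` G j.
  move=> /subnK <-; elim: (j - i)%N => // m ih.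
  by apply: subset_trans ih _; have [] := tS (m + i)%N.
have Gs i j h : (i <= j)%N -> G i h -> h (s j) = h (s i).
  move=> /subnK <- Gh; elim: (j - i)%N => // m <-.
  by have [_ + _] := tS (m + i)%N; apply; apply: Gmono Gh; exact: leq_addl.
have /choice[g gP] k : exists g, [/\ F g, ~ G k g, G k.+1 g & 1 / 2 <= `|g (s k.+1)|].
  by have [_ _ []] := tS k => g ?; exists g.
exists s, g; split.
(* The bound on [F] passes to the norm, as some member of [F] dominates [|s k|]. *)
- move=> k; have [g0 Fg0 /le_trans] := Fnorm (s k); apply.
  by have [_ + _] := svalP (t k); apply.
- by move=> k; have [] := gP k.
(* [g i] is frozen from stage [i.+1] on, while [g j] is not yet frozen at stage [j]. *)
- have gneq i j : (i < j)%N -> g i != g j.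
    move=> ij; apply/eqP => gij; have [_ + _ _] := gP j; apply; rewrite -gij.
    by apply: (Gmono _ _ ij); have [] := gP i.
  move=> i j gij; have [/gneq|/gneq|//] := ltngtP i j; by rewrite gij eqxx.
- move=> k j kj; have [_ _ Gg gs] := gP k.
  by rewrite (Gs _ _ _ kj Gg).
Qed.

(** The model is [c_0]: the sums of its first [k] unit vectors are bounded but have no weak limit,
    since all coordinates of the limit would be 1. *)
Lemma reflexive_no_null_norming (R : realType) (X : normedModType R)
    (F : set (dual X)) :
  reflexive_space X ->
  (forall x e, 0 < e -> finite_set [set g | F g /\ e <= `|g x|]) ->
  (forall x, exists2 g, F g & `|x| <= `|g x|) ->
  finite_dimensional X.
Proof.
move=> reflX Ffin Fnorm; apply: contrapT => infX.
have [s [g [s_le Fg g_inj gs]]] := gliding_hump _ _ _ infX Ffin Fnorm.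
have [U [ultraU ooU]] := ultraFilterLemma (eventually_filter).
have properU : ProperFilter U by exact: ultra_proper.
have [x sx] := reflexive_ultra_weak_cvg _ _ _ U _ _ reflX ultraU s_le.
(* [g k (s t)] is constant in [t] from [k.+1] on, and [U] refines the eventual filter. *)
have gx k : g k x = g k (s k.+1).
  apply: (@cvg_unique _ (@Rhausdorff R) (g k (s t) @[t --> U])); first exact: sx.
  apply: cvg_near_cst; apply: ooU; exists k.+1 => // j /= kj.
  by have [] := gs _ _ kj.
have /infinite_nat// : finite_set [set: nat].
have half_gt0 : 0 < 1 / 2 :> R by lra.
apply: sub_finite_set (finite_preimage (f := g) _ (Ffin x _ half_gt0)).
  by move=> k _; split => //; rewrite gx; have [] := gs k k.+1 (ltnSn k).
by move=> i j _ _; exact: g_inj.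
Qed.

(** * Slices determine their functionals *)

Definition slice_of {R : realType} {X : normedModType R} (g : dual X)
  (A : set X) := A = [set x | 1 <= g x] \/ A = [set x | 1 < g x].

Lemma slice_le (R : realType) (X : normedModType R) (g h : dual X) A x :
  slice_of g A -> slice_of h A -> 0 < g x -> g x <= h x.
Proof.
move=> gA hA gx0; rewrite leNgt; apply/negP => hg.
(* [h (x / m) < 1 < g (x / m)], so [x / m] separates the two slices. *)
pose m := (g x + Num.max (h x) 0) / 2.
have [hm m0 mg] : [/\ h x < m, 0 < m & m < g x].
  by rewrite /m; have [h0|h0] := leP (h x) 0; split; lra.
have Ax : A (m^-1 *: x).
  have : 1 < g (m^-1 *: x) by rewrite dualZ mulrC ltr_pdivlMr// mul1r.
  by case: gA => -> //=; exact: ltW.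
have : 1 <= h (m^-1 *: x) by case: hA Ax => -> //=; exact: ltW.
by rewrite dualZ mulrC ler_pdivlMr// mul1r leNgt hm.
Qed.

(** [slice_le] in both directions gives equality wherever one functional is positive; negative
    values are handled at [- x]. Point-finiteness counts sets, and this turns it into a count of
    functionals. *)
Lemma slice_inj (R : realType) (X : normedModType R) (g h : dual X) A :
  slice_of g A -> slice_of h A -> g = h.
Proof.
move=> gA hA; apply/val_inj/funext => x /=.
have pos (a b : dual X) z : slice_of a A -> slice_of b A -> 0 < a z -> a z = b z.
  move=> aA bA az; have ab := slice_le _ _ _ _ _ _ aA bA az.
  by apply: le_anti; rewrite ab/= (slice_le _ _ _ _ _ _ bA aA)// (lt_le_trans az).
have [gx|gx|gx] := ltgtP (g x) 0.
- by apply: oppr_inj; rewrite -!dualN; apply: pos; rewrite // dualN oppr_gt0.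
- exact: pos.
- have [hx|hx|hx] := ltgtP (h x) 0; last by rewrite gx hx.
  + by apply: oppr_inj; rewrite -!dualN; apply/esym/pos; rewrite // dualN oppr_gt0.
  + exact/esym/pos.
Qed.

Theorem theorem2p5 (R : realType) (X : completeNormedModType R)
  (X_infinite_dimensional : ~ finite_dimensional X)
  (X_reflexive : reflexive_space X)
  (f : nat -> dual X) (f_ge1 : forall n, 1 <= `|f n|)
  (S : nat -> set X)
  (SE : forall n, S n = [set x | 1 <= f n x] \/ S n = [set x | 1 < f n x])
  (S_cover : [set x : X | `|x| = 1] `<=` \bigcup_(A in range S) A) :
  ~ point_finite (range S).
Proof.
move=> pf; apply: X_infinite_dimensional.
apply: (@reflexive_no_null_norming _ _ (range f)) => //.
- move=> x e e0.
  (* [slice] recovers the functional from its set, consistently by [slice_inj]; sets outside the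
     family get the default 0. *)
  have [slice sliceP] : exists sl : set X -> dual X, forall n, sl (S n) = f n.
    have /choice[sl slP] A : exists g, forall n, A = S n -> g = f n.
      have [[n ->]|An] := pselect (exists n, A = S n).
        by exists (f n) => m nm; apply: slice_inj (SE n) _; rewrite nm; exact: SE.
      by exists 0 => n AS; case: An; exists n.
    by exists sl => n; exact: slP.
  have fin y : finite_set [set g | range f g /\ 1 < g y].
    apply: sub_finite_set (finite_image slice (pf y)) => _ [[n _ <-] fy].
    exists (S n) => //; split; first by exists n.
    by case: (SE n) => -> //=; exact: ltW.
  (* If [e <= |g x|], then [g] is at least 2, hence strictly above 1, at one of the points
     [(2 / e) *: x] and [(2 / e) *: - x], according to the sign of [g x]. *)
  have : finite_set ([set g | range f g /\ 1 < g ((2 / e) *: x)] `|`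
                     [set g | range f g /\ 1 < g ((2 / e) *: - x)]).
    by rewrite finite_setU; split; exact: fin.
  apply: sub_finite_set => g [Fg egx].
  have [gx|gx] := leP 0 (g x); [left|right]; split => //.
    rewrite dualZ mulrAC ltr_pdivlMr// mul1r.
    by move: egx; rewrite ger0_norm//; lra.
  rewrite dualZ dualN mulrAC ltr_pdivlMr// mul1r.
  by move: egx; rewrite ltr0_norm//; lra.
- move=> x; have [->|x0] := eqVneq x 0.
    by exists (f 0%N); [exists 0%N|rewrite normr0].
  have nx0 : 0 < `|x| by rewrite normr_gt0.
  (* The slice covering [x / |x|] provides the norming functional. *)
  have [|_ [n _ <-] Snx] := S_cover (`|x|^-1 *: x).
    by rewrite /= normrZ normfV normr_id mulVf// gt_eqF.
  exists (f n); first by exists n.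
  have : 1 <= f n (`|x|^-1 *: x) by case: (SE n) Snx => -> //=; exact: ltW.
  rewrite dualZ mulrC ler_pdivlMr// mul1r => /le_trans; apply.
  exact: ler_norm.
Qed.
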